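(* The following equivalences of types hold: (1) the type of posets is equivalent to the type of univalent semi-Segal sets; (2) the type of univalent categories is equivalent to the type of univalent semi-Segal 1-types; (3) the type of univalent 2-categories is equivalent to the type of univalent semi-Segal 2-types.
   Context: Work in homotopy type theory (intensional Martin-Löf type theory with $\Pi$-, $\Sigma$-, unit and identity types and a univalent universe $\mathcal U$). For $p:a=b$, $q:b=c$, $p\cdot q:a=c$ is concatenation; $\mathsf{ap}_F$ is the action of a function $F$ on paths. Categorical structures. A reflexive-transitive graph consists of $\mathsf{Ob}:\mathcal U$, $\mathsf{Hom}:\mathsf{Ob}\times\mathsf{Ob}\to\mathcal U$, composition $\_\circ\_:\Pi abc,\ \mathsf{Hom}(b,c)\times\mathsf{Hom}(a,b)\to\mathsf{Hom}(a,c)$ and $\mathsf{Id}:\Pi x,\mathsf{Hom}(x,x)$. A wild precategory has in addition $\alpha:\Pi fgh,\ h\circ(g\circ f)=(h\circ g)\circ f$ (all composable $f,g,h$), $\lambda_f:\mathsf{Id}_y\circ f=f$ and $\rho_f:f\circ\mathsf{Id}_x=f$ for all $f:\mathsf{Hom}(x,y)$. A wild 2-precategory has in addition a pentagonator, an element of $$\Pi fghk,\ \mathsf{ap}_{k\circ\_}(\alpha(f,g,h))\cdot\alpha(f,h\circ g,k)\cdot\mathsf{ap}_{\_\circ f}(\alpha(g,h,k))=\alpha(g\circ f,h,k)\cdot\alpha(f,g,k\circ h),$$ and, for all $f:\mathsf{Hom}(x,y)$, $g:\mathsf{Hom}(y,z)$, equalities $t_1:\mathsf{ap}_{g\circ\_}(\lambda_f)=\alpha(f,\mathsf{Id},g)\cdot\mathsf{ap}_{\_\circ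 f}(\rho_g)$, $t_0:\lambda_{g\circ f}=\alpha(f,g,\mathsf{Id})\cdot\mathsf{ap}_{\_\circ f}(\lambda_g)$, $t_2:\mathsf{ap}_{g\circ\_}(\rho_f)=\alpha(\mathsf{Id},f,g)\cdot\rho_{g\circ f}$. Semi-Segal types. For $0\le n\le 4$, an $n$-restricted semisimplicial type is a tuple $(A_0,\dots,A_n)$ with $A_0:\mathcal U$ and, for $1\le k\le n$, $A_k:\partial\mathbf\Delta^k\to\mathcal U$. Here $\partial\mathbf\Delta^k$ is the iterated $\Sigma$-type with one component $x_S$ for every nonempty proper subset $S\subsetneq\{0,\dots,k\}$, where $x_S:A_{|S|-1}\big((x_T)_{\emptyset\ne T\subsetneq S}\big)$ (reindexed along the order-preserving bijection $S\cong\{0,\dots,|S|-1\}$), and $x_i:A_0$ for singletons. $\mathbf\Delta^k$ is the same $\Sigma$-type with one further component $x_{0\cdots k}:A_k(\ldots)$ over that boundary. For $2\le k\le n$ and $0\le m\le k$, $\Lambda^k_m$ is the $\Sigma$-type with the same components as $\partial\mathbf\Delta^k$ except that $x_{\{0,\dots,k\}\setminus\{m\}}$ is removed. The type of fillers of $u:\Lambda^k_m$ is the type of pairs $(x_{\{0,\dots,k\}\setminus\{m\}},x_{\{0,\dots,k\}})$; contractible $(k,m)$-horn filling means that this type is contractible for all $u:\Lambda^k_m$. An $n$-restricted semi-Segal type ($1\le n\le4$) is an $n$-restricted semisimplicial type with contractible $(p,1)$-horn filling for every $p\in\{2,\dots,n\}$. Degeneracy structures. A 1-degeneracy structure is a function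 $s^0_0:\Pi(x_0:A_0),A_1(x_0,x_0)$. A 2-degeneracy structure is $s^0_0$ together with functions assigning to each $(x_0,x_1,x_{01}):\mathbf\Delta^1$ an element of $A_2(u)$ for the boundaries $u$: for $s^1_0$: $u_0=u_1=x_0$, $u_2=x_1$, $u_{01}=s^0_0(x_0)$, $u_{02}=u_{12}=x_{01}$; for $s^1_1$: $u_0=x_0$, $u_1=u_2=x_1$, $u_{01}=u_{02}=x_{01}$, $u_{12}=s^0_0(x_1)$. A 3-degeneracy structure is a 2-degeneracy structure together with functions assigning to each $x:\mathbf\Delta^2$ (with components $x_0,x_1,x_2,x_{01},x_{12},x_{02},x_{012}$) an element of $A_3(u)$ for the boundaries $u$: for $s^2_0$: $u_0=u_1=x_0$, $u_2=x_1$, $u_3=x_2$; $u_{01}=s^0_0(x_0)$, $u_{02}=u_{12}=x_{01}$, $u_{03}=u_{13}=x_{02}$, $u_{23}=x_{12}$; $u_{012}=s^1_0(x_{01})$, $u_{013}=s^1_0(x_{02})$, $u_{023}=u_{123}=x_{012}$; for $s^2_1$: $u_0=x_0$, $u_1=u_2=x_1$, $u_3=x_2$; $u_{01}=u_{02}=x_{01}$, $u_{12}=s^0_0(x_1)$, $u_{03}=x_{02}$, $u_{13}=u_{23}=x_{12}$; $u_{012}=s^1_1(x_{01})$, $u_{013}=u_{023}=x_{012}$, $u_{123}=s^1_0(x_{12})$; for $s^2_2$: $u_0=x_0$, $u_1=x_1$, $u_2=u_3=x_2$; $u_{01}=x_{01}$, $u_{02}=u_{03}=x_{02}$, $u_{12}=u_{13}=x_{12}$,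 $u_{23}=s^0_0(x_2)$; $u_{012}=u_{013}=x_{012}$, $u_{023}=s^1_1(x_{02})$, $u_{123}=s^1_1(x_{12})$. For $n\in\{2,3,4\}$, an $n$-restricted semi-Segal type with degeneracies is an $n$-restricted semi-Segal type equipped with an $(n-1)$-degeneracy structure. It has an associated reflexive-transitive graph: $\mathsf{Ob}=A_0$, $\mathsf{Hom}=A_1$, $\mathsf{Id}=s^0_0$, and $x_{12}\circ x_{01}$ is the $x_{02}$-component of the unique filler of the $\Lambda^2_1$-horn given by $x_{01},x_{12}$. Univalence. For a morphism $f:\mathsf{Hom}(x,y)$ of a reflexive-transitive graph, $\mathsf{isIso}(f):\equiv\big(\Sigma(g:\mathsf{Hom}(y,x)),g\circ f=\mathsf{Id}_x\big)\times\big(\Sigma(g:\mathsf{Hom}(y,x)),f\circ g=\mathsf{Id}_y\big)$, and $x\cong y:\equiv\Sigma(f:\mathsf{Hom}(x,y)),\mathsf{isIso}(f)$. For semi-Segal types with degeneracies these notions refer to the associated reflexive-transitive graph. A structure is sufficient if it has at least 3 levels (a wild precategory, wild 2-precategory, or 3- or 4-restricted semi-Segal type with degeneracies), or if the morphisms/edges form a family of propositions. In a sufficient structure $\mathsf{Id}_x$ is an isomorphism, and $\mathsf{idtoiso}:x=y\to x\cong y$ is defined by path induction sending $\mathsf{refl}_x$ to $\mathsf{Id}_x$; the structure is univalent if $\mathsf{idtoiso}$ is an equivalence for all $x,y$. A poset is a univalent reflexive-transitive graph where $\mathsf{Hom}$ is a family of propositions; a univalent category is a univalent wild precategory where $\mathsf{Hom}$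 is a family of sets; a univalent 2-category is a univalent wild 2-precategory where $\mathsf{Hom}$ is a family of 1-types. A univalent semi-Segal set (resp. 1-type, 2-type) is a univalent 2- (resp. 3-, 4-) restricted semi-Segal type with degeneracies where $A_1$ is a family of propositions (resp. sets, 1-types). *)

(* Defs.v *)
(* Rocq is the ambient intensional type theory.  [eq] is the identity type: it
   is eliminated with full J into arbitrary types, and nothing below truncates
   it.  In particular "is a proposition", "is a set", ... are the homotopical
   notions, unrelated to the sort [Prop], and [sigT] is used for every Sigma. *)

Set Implicit Arguments.
Unset Strict Implicit.
Unset Printing Implicit Defensive.
Set Primitive Projections.

Definition is_contr (A : Type) : Type := {c : A & forall x : A, c = x}.
Definition is_prop (A : Type) : Type := forall x y : A, x = y.
Definition is_set (A : Type) : Type := forall x y : A, is_prop (x = y).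
Definition is_1type (A : Type) : Type := forall x y : A, is_set (x = y).

Definition is_equiv (A B : Type) (f : A -> B) : Type :=
  forall b : B, is_contr {a : A & f a = b}.

Definition equiv (A B : Type) : Type := {f : A -> B & is_equiv f}.

Notation "A <~> B" := (equiv A B) (at level 70, no associativity).

Lemma is_equiv_id (A : Type) : is_equiv (fun a : A => a).
Proof.
  intro b. exists (existT (fun a => a = b) b eq_refl).
  intros [a p]. destruct p. reflexivity.
Defined.

Arguments is_equiv_id A b : clear implicits.

Definition equiv_id (A : Type) : A <~> A := existT (@is_equiv A A) _ (is_equiv_id A).

(* The univalent universe is a variable: a universe a la Tarski, closed under
   unit, Pi, Sigma and identity types, closure being required only up to
   equivalence.  Univalence cannot be assumed of [Type] itself: as [eq] lives in
   the impredicative sort [Prop], it would make [A <~> B] equivalent to a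
   [Prop] for all large [A] and [B], which is contradictory. *)
Record universe : Type := {
  code :> Type;
  El : code -> Type;
  c_unit : code;
  El_unit : El c_unit <~> unit;
  c_pi : forall A : code, (El A -> code) -> code;
  El_pi : forall (A : code) (B : El A -> code),
    El (c_pi B) <~> (forall x : El A, El (B x));
  c_sigma : forall A : code, (El A -> code) -> code;
  El_sigma : forall (A : code) (B : El A -> code),
    El (c_sigma B) <~> {x : El A & El (B x)};
  c_id : forall A : code, El A -> El A -> code;
  El_id : forall (A : code) (a b : El A), El (c_id a b) <~> (a = b)
}.

Coercion El : code >-> Sortclass.

Definition idtoequiv (U : universe) (A B : U) (p : A = B) : A <~> B :=
  match p in _ = C return A <~> C with eq_refl => equiv_id A end.

Definition univalence (U : universe) : Type :=
  forall A B : U, is_equiv (@idtoequiv U A B).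

(** ** Categorical structures *)

Record rt_graph (U : universe) : Type := {
  Ob : U;
  Hom : Ob -> Ob -> U;
  comp : forall a b c : Ob, Hom b c -> Hom a b -> Hom a c;
  Id : forall x : Ob, Hom x x
}.

Arguments Ob {U} r.
Arguments Hom {U} r x y.
Arguments comp {U r a b c} g f.
Arguments Id {U r} x.

Notation "g ∘ f" := (comp g f) (at level 40, left associativity).
Notation "p @ q" := (eq_trans p q) (at level 50, left associativity).

Record wild_precategory (U : universe) : Type := {
  graph_of_precat :> rt_graph U;
  assoc : forall (x y z w : Ob graph_of_precat)
    (f : Hom _ x y) (g : Hom _ y z) (h : Hom _ z w), h ∘ (g ∘ f) = (h ∘ g) ∘ f;
  unit_l : forall (x y : Ob graph_of_precat) (f : Hom _ x y), Id y ∘ f = f;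
  unit_r : forall (x y : Ob graph_of_precat) (f : Hom _ x y), f ∘ Id x = f
}.

Arguments assoc {U C x y z w} f g h : rename.
Arguments unit_l {U C x y} f : rename.
Arguments unit_r {U C x y} f : rename.

Record wild_2precategory (U : universe) : Type := {
  precat_of_2precat :> wild_precategory U;
  pentagonator : forall (a b c d e : Ob precat_of_2precat)
    (f : Hom _ a b) (g : Hom _ b c) (h : Hom _ c d) (k : Hom _ d e),
    f_equal (fun t => k ∘ t) (assoc f g h) @ assoc f (h ∘ g) k
      @ f_equal (fun t => t ∘ f) (assoc g h k)
    = assoc (g ∘ f) h k @ assoc f g (k ∘ h);
  triangle_1 : forall (x y z : Ob precat_of_2precat)
    (f : Hom _ x y) (g : Hom _ y z),
    f_equal (fun t => g ∘ t) (unit_l f)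
    = assoc f (Id y) g @ f_equal (fun t => t ∘ f) (unit_r g);
  triangle_0 : forall (x y z : Ob precat_of_2precat)
    (f : Hom _ x y) (g : Hom _ y z),
    unit_l (g ∘ f)
    = assoc f g (Id z) @ f_equal (fun t => t ∘ f) (unit_l g);
  triangle_2 : forall (x y z : Ob precat_of_2precat)
    (f : Hom _ x y) (g : Hom _ y z),
    f_equal (fun t => g ∘ t) (unit_r f)
    = assoc (Id x) f g @ unit_r (g ∘ f)
}.

(** ** Univalence of a reflexive-transitive graph *)

Definition is_iso (U : universe) (G : rt_graph U) (x y : Ob G)
    (f : Hom G x y) : Type :=
  ({g : Hom G y x & g ∘ f = Id x} * {g : Hom G y x & f ∘ g = Id y})%type.

Definition iso (U : universe) (G : rt_graph U) (x y : Ob G) : Type :=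
  {f : Hom G x y & is_iso f}.

(* The only thing needed to see that identities are isomorphisms.  Each kind of
   sufficient structure provides it below; there [is_iso f] is a proposition,
   so that the proof used is immaterial. *)
Definition id_idempotent (U : universe) (G : rt_graph U) : Type :=
  forall x : Ob G, Id x ∘ Id x = Id x.

Definition iso_id (U : universe) (G : rt_graph U) (e : id_idempotent G)
    (x : Ob G) : iso x x :=
  existT _ (Id x) (existT _ (Id x) (e x), existT _ (Id x) (e x)).

Definition idtoiso (U : universe) (G : rt_graph U) (e : id_idempotent G)
    (x y : Ob G) (p : x = y) : iso x y :=
  match p in _ = z return iso x z with eq_refl => iso_id e x end.

Definition is_univalent (U : universe) (G : rt_graph U)
    (e : id_idempotent G) : Type :=
  forall x y : Ob G, is_equiv (@idtoiso U G e x y).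

Definition id_idempotent_prop (U : universe) (G : rt_graph U)
    (h : forall x y : Ob G, is_prop (Hom G x y)) : id_idempotent G :=
  fun x => h x x (Id x ∘ Id x) (Id x).

Definition id_idempotent_precat (U : universe) (C : wild_precategory U) :
    id_idempotent C :=
  fun x => unit_l (Id x).

Arguments id_idempotent_prop {U G} h x.
Arguments id_idempotent_precat {U} C x.

Record poset (U : universe) : Type := {
  poset_graph :> rt_graph U;
  poset_prop : forall x y : Ob poset_graph, is_prop (Hom poset_graph x y);
  poset_univalent : is_univalent (id_idempotent_prop poset_prop)
}.

Record univalent_category (U : universe) : Type := {
  ucat_precat :> wild_precategory U;
  ucat_set : forall x y : Ob ucat_precat, is_set (Hom ucat_precat x y);
  ucat_univalent : is_univalent (id_idempotent_precat ucat_precat)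
}.

Record univalent_2category (U : universe) : Type := {
  u2cat_2precat :> wild_2precategory U;
  u2cat_1type :
    forall x y : Ob u2cat_2precat, is_1type (Hom u2cat_2precat x y);
  u2cat_univalent : is_univalent (id_idempotent_precat u2cat_2precat)
}.

(** ** Restricted semisimplicial types *)

(* A family over the boundary of the k-simplex is written in curried form. *)

Record semisimplicial_2 (U : universe) : Type := {
  A0 : U;
  A1 : A0 -> A0 -> U;
  A2 : forall x0 x1 x2 : A0, A1 x0 x1 -> A1 x0 x2 -> A1 x1 x2 -> U
}.

Arguments A0 {U} s.
Arguments A1 {U} s x0 x1.
Arguments A2 {U s x0 x1 x2} x01 x02 x12.

Record semisimplicial_3 (U : universe) : Type := {
  ss2_of_ss3 :> semisimplicial_2 U;
  A3 : forall (x0 x1 x2 x3 : A0 ss2_of_ss3)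
    (x01 : A1 _ x0 x1) (x02 : A1 _ x0 x2) (x03 : A1 _ x0 x3)
    (x12 : A1 _ x1 x2) (x13 : A1 _ x1 x3) (x23 : A1 _ x2 x3),
    A2 x01 x02 x12 -> A2 x01 x03 x13 -> A2 x02 x03 x23 -> A2 x12 x13 x23 -> U
}.

Arguments A3 {U s x0 x1 x2 x3 x01 x02 x03 x12 x13 x23} x012 x013 x023 x123.

Record semisimplicial_4 (U : universe) : Type := {
  ss3_of_ss4 :> semisimplicial_3 U;
  A4 : forall (x0 x1 x2 x3 x4 : A0 ss3_of_ss4)
    (x01 : A1 _ x0 x1) (x02 : A1 _ x0 x2) (x03 : A1 _ x0 x3)
    (x04 : A1 _ x0 x4) (x12 : A1 _ x1 x2) (x13 : A1 _ x1 x3)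
    (x14 : A1 _ x1 x4) (x23 : A1 _ x2 x3) (x24 : A1 _ x2 x4)
    (x34 : A1 _ x3 x4)
    (x012 : A2 x01 x02 x12) (x013 : A2 x01 x03 x13) (x014 : A2 x01 x04 x14)
    (x023 : A2 x02 x03 x23) (x024 : A2 x02 x04 x24) (x034 : A2 x03 x04 x34)
    (x123 : A2 x12 x13 x23) (x124 : A2 x12 x14 x24) (x134 : A2 x13 x14 x34)
    (x234 : A2 x23 x24 x34),
    A3 x012 x013 x023 x123 -> A3 x012 x014 x024 x124 ->
    A3 x013 x014 x034 x134 -> A3 x023 x024 x034 x234 ->
    A3 x123 x124 x134 x234 -> U
}.

Arguments A4 {U s x0 x1 x2 x3 x4 x01 x02 x03 x04 x12 x13 x14 x23 x24 x34
  x012 x013 x014 x023 x024 x034 x123 x124 x134 x234}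
  x0123 x0124 x0134 x0234 x1234.

(** ** Contractible (k,1)-horn filling *)

Definition has_horn_fillers_2 (U : universe) (X : semisimplicial_2 U) : Type :=
  forall (x0 x1 x2 : A0 X) (x01 : A1 X x0 x1) (x12 : A1 X x1 x2),
    is_contr {x02 : A1 X x0 x2 & A2 x01 x02 x12}.

Definition has_horn_fillers_3 (U : universe) (X : semisimplicial_3 U) : Type :=
  forall (x0 x1 x2 x3 : A0 X)
    (x01 : A1 X x0 x1) (x02 : A1 X x0 x2) (x03 : A1 X x0 x3)
    (x12 : A1 X x1 x2) (x13 : A1 X x1 x3) (x23 : A1 X x2 x3)
    (x012 : A2 x01 x02 x12) (x013 : A2 x01 x03 x13) (x123 : A2 x12 x13 x23),
    is_contr {x023 : A2 x02 x03 x23 & A3 x012 x013 x023 x123}.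

Definition has_horn_fillers_4 (U : universe) (X : semisimplicial_4 U) : Type :=
  forall (x0 x1 x2 x3 x4 : A0 X)
    (x01 : A1 X x0 x1) (x02 : A1 X x0 x2) (x03 : A1 X x0 x3)
    (x04 : A1 X x0 x4) (x12 : A1 X x1 x2) (x13 : A1 X x1 x3)
    (x14 : A1 X x1 x4) (x23 : A1 X x2 x3) (x24 : A1 X x2 x4)
    (x34 : A1 X x3 x4)
    (x012 : A2 x01 x02 x12) (x013 : A2 x01 x03 x13) (x014 : A2 x01 x04 x14)
    (x023 : A2 x02 x03 x23) (x024 : A2 x02 x04 x24) (x034 : A2 x03 x04 x34)
    (x123 : A2 x12 x13 x23) (x124 : A2 x12 x14 x24) (x134 : A2 x13 x14 x34)
    (x234 : A2 x23 x24 x34)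
    (x0123 : A3 x012 x013 x023 x123) (x0124 : A3 x012 x014 x024 x124)
    (x0134 : A3 x013 x014 x034 x134) (x1234 : A3 x123 x124 x134 x234),
    is_contr {x0234 : A3 x023 x024 x034 x234 &
              A4 x0123 x0124 x0134 x0234 x1234}.

(** ** Degeneracy structures *)

Definition degeneracies_1 (U : universe) (X : semisimplicial_2 U) : Type :=
  forall x0 : A0 X, A1 X x0 x0.

(* [sij] is the degeneracy written s^i_j. *)
Record degeneracies_2 (U : universe) (X : semisimplicial_2 U) : Type := {
  s00 : degeneracies_1 X;
  s10 : forall (x0 x1 : A0 X) (x01 : A1 X x0 x1), A2 (s00 x0) x01 x01;
  s11 : forall (x0 x1 : A0 X) (x01 : A1 X x0 x1), A2 x01 x01 (s00 x1)
}.

Arguments s00 {U X} d x0.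
Arguments s10 {U X} d {x0 x1} x01.
Arguments s11 {U X} d {x0 x1} x01.

Record degeneracies_3 (U : universe) (X : semisimplicial_3 U) : Type := {
  deg2_of_deg3 :> degeneracies_2 X;
  s20 : forall (x0 x1 x2 : A0 X)
    (x01 : A1 X x0 x1) (x02 : A1 X x0 x2) (x12 : A1 X x1 x2)
    (x012 : A2 x01 x02 x12),
    A3 (s10 deg2_of_deg3 x01) (s10 deg2_of_deg3 x02) x012 x012;
  s21 : forall (x0 x1 x2 : A0 X)
    (x01 : A1 X x0 x1) (x02 : A1 X x0 x2) (x12 : A1 X x1 x2)
    (x012 : A2 x01 x02 x12),
    A3 (s11 deg2_of_deg3 x01) x012 x012 (s10 deg2_of_deg3 x12);
  s22 : forall (x0 x1 x2 : A0 X)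
    (x01 : A1 X x0 x1) (x02 : A1 X x0 x2) (x12 : A1 X x1 x2)
    (x012 : A2 x01 x02 x12),
    A3 x012 x012 (s11 deg2_of_deg3 x02) (s11 deg2_of_deg3 x12)
}.

(** ** Semi-Segal types with degeneracies *)

Definition semi_segal_graph (U : universe) (X : semisimplicial_2 U)
    (h : has_horn_fillers_2 X) (s : degeneracies_1 X) : rt_graph U := {|
  Ob := A0 X;
  Hom := A1 X;
  comp := fun x0 x1 x2 x12 x01 => projT1 (projT1 (h x0 x1 x2 x01 x12));
  Id := s
|}.

Lemma id_idempotent_semi_segal (U : universe) (X : semisimplicial_2 U)
    (h : has_horn_fillers_2 X) (d : degeneracies_2 X) :
  id_idempotent (semi_segal_graph h (s00 d)).
Proof.
  intro x.
  exact (f_equal (@projT1 _ _)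
    (projT2 (h x x x (s00 d x) (s00 d x)) (existT _ (s00 d x) (s10 d (s00 d x))))).
Defined.

Arguments id_idempotent_semi_segal {U X} h d x.

Record semi_segal_deg_2 (U : universe) : Type := {
  ss_of_segal2 :> semisimplicial_2 U;
  segal2_fill2 : has_horn_fillers_2 ss_of_segal2;
  segal2_deg : degeneracies_1 ss_of_segal2
}.

Record semi_segal_deg_3 (U : universe) : Type := {
  ss_of_segal3 :> semisimplicial_3 U;
  segal3_fill2 : has_horn_fillers_2 ss_of_segal3;
  segal3_fill3 : has_horn_fillers_3 ss_of_segal3;
  segal3_deg : degeneracies_2 ss_of_segal3
}.

Record semi_segal_deg_4 (U : universe) : Type := {
  ss_of_segal4 :> semisimplicial_4 U;
  segal4_fill2 : has_horn_fillers_2 ss_of_segal4;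
  segal4_fill3 : has_horn_fillers_3 ss_of_segal4;
  segal4_fill4 : has_horn_fillers_4 ss_of_segal4;
  segal4_deg : degeneracies_3 ss_of_segal4
}.

Arguments segal2_fill2 {U} s x0 x1 x2 x01 x12.
Arguments segal2_deg {U} s x0.
Arguments segal3_fill2 {U} s x0 x1 x2 x01 x12.
Arguments segal3_deg {U} s.
Arguments segal4_fill2 {U} s x0 x1 x2 x01 x12.
Arguments segal4_deg {U} s.

Definition graph_of_segal2 (U : universe) (X : semi_segal_deg_2 U) :
    rt_graph U :=
  semi_segal_graph (segal2_fill2 X) (segal2_deg X).

Record univalent_semi_segal_set (U : universe) : Type := {
  usss_carrier :> semi_segal_deg_2 U;
  usss_prop : forall x y : A0 usss_carrier, is_prop (A1 usss_carrier x y);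
  usss_univalent :
    is_univalent
      (id_idempotent_prop (G := graph_of_segal2 usss_carrier) usss_prop)
}.

Record univalent_semi_segal_1type (U : universe) : Type := {
  uss1_carrier :> semi_segal_deg_3 U;
  uss1_set : forall x y : A0 uss1_carrier, is_set (A1 uss1_carrier x y);
  uss1_univalent :
    is_univalent (id_idempotent_semi_segal (segal3_fill2 uss1_carrier)
                                           (segal3_deg uss1_carrier))
}.

Record univalent_semi_segal_2type (U : universe) : Type := {
  uss2_carrier :> semi_segal_deg_4 U;
  uss2_1type : forall x y : A0 uss2_carrier, is_1type (A1 uss2_carrier x y);
  uss2_univalent :
    is_univalent (id_idempotent_semi_segal (segal4_fill2 uss2_carrier)
                                           (segal4_deg uss2_carrier))
}.

(* Main.v *)
Require Import Defs.
From Stdlib Require Import FunctionalExtensionality.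

Set Implicit Arguments.
Unset Strict Implicit.
Unset Printing Implicit Defensive.

(** Each of the three equivalences adds one level to the previous one, and every
    level works in the same way.

    By univalence, a family [P : B -> U] with contractible total space is the
    same thing as a point of [B], since it is the family of paths out of the
    centre of its total space ([equiv_uniquely_filled]).  A semisimplicial level
    together with contractible horn filling is a product of such families over
    the horns, so it amounts to a choice of a filler for every horn.  Conversely,
    the simplices with given other faces being exactly paths out of the chosen
    filler ([equiv_to_path]), any statement quantified over a simplex may be
    contracted to the case of the chosen filler ([equiv_contract]).

    - Level 2.  Fillers of the horns [x01, x12] are composites, so that semi-Segal
      types with an identity at every point are reflexive-transitive graphs
      ([is_equiv_graph]).

    - Level 3.  A triangle is a path from a composite to an edge.  A choice of
      fillers of 3-horns is then determined by its value on composition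
      triangles, which is an associator, and the degenerate triangles are the
      unit laws.  So 3-restricted semi-Segal types with degeneracies are wild
      precategories ([is_equiv_precat]).

    - Level 4.  A tetrahedron is a proof that the associator relates the paths
      given by its four faces ([equiv_tetrahedron]).  After contraction, fillers
      of 4-horns are pentagonators, and the degenerate tetrahedra are the three
      triangle laws; this gives the wild 2-precategories ([equiv_2precat]).

    These equivalences keep objects and morphisms fixed, so truncation conditions
    on morphisms correspond literally.  Univalence of the structure corresponds as
    well: the two sides may show in different ways that an identity is an
    isomorphism, but being an isomorphism is a proposition in a wild precategory
    ([equiv_is_univalent]).

    Equalities are never assumed to be proof-irrelevant.  Function extensionality
    is used as a principle of its own: univalence of [U] concerns functions
    between types of [U], while the structures compared here contain families of
    codes. *)

(** * Contractible types and equivalences *)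

Lemma is_contr_is_prop (A : Type) : is_contr A -> is_prop A.
Proof.
  intros [c h] x y. exact (eq_sym (h x) @ h y).
Qed.

Lemma is_prop_is_set (A : Type) : is_prop A -> is_set A.
Proof.
  intros h x y p q.
  assert (k : forall z (r : x = z), r = eq_sym (h x x) @ h x z).
  { intros z r. destruct r. destruct (h x x). reflexivity. }
  rewrite (k y p). symmetry. apply k.
Qed.

Lemma is_prop_pi (A : Type) (B : A -> Type) :
  (forall x, is_prop (B x)) -> is_prop (forall x, B x).
Proof.
  intros h f g. apply functional_extensionality_dep. intro x. apply h.
Qed.

Lemma is_prop_is_contr (A : Type) : is_prop (is_contr A).
Proof.
  intros [c h] [c' h']. destruct (h c').
  apply f_equal. apply is_prop_pi. intro x.
  apply is_prop_is_set. apply is_contr_is_prop. exact (existT _ c h).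
Qed.

Lemma eq_trans_cancel_r (A : Type) (x y z : A) (p q : x = y) (r : y = z) :
  p @ r = q @ r -> p = q.
Proof.
  destruct r. exact (fun e => e).
Qed.

Lemma eq_trans_sym_cancel (A : Type) (x y z : A) (p : x = y) (q : y = z) :
  eq_sym p @ (p @ q) = q.
Proof.
  destruct q, p. reflexivity.
Qed.

Lemma homotopy_natural (A B : Type) (f g : A -> B) (s : forall a, f a = g a)
    (x y : A) (p : x = y) :
  s x @ f_equal g p = f_equal f p @ s y.
Proof.
  destruct p. simpl. destruct (s x). reflexivity.
Qed.

Lemma homotopy_id_natural (A : Type) (f : A -> A) (r : forall a, f a = a)
    (x : A) :
  r (f x) = f_equal f (r x).
Proof.
  apply eq_trans_cancel_r with (r := r x).
  rewrite <- (homotopy_natural (g := fun a => a) r (r x)).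
  now destruct (r x).
Qed.

(** Fibres must be contractible, which asks for the two homotopies to be
    compatible; one of them can always be adjusted so that they are. *)
Lemma is_equiv_of_inverse (A B : Type) (f : A -> B) (g : B -> A)
    (s : forall b, f (g b) = b) (r : forall a, g (f a) = a) : is_equiv f.
Proof.
  (* The usual half-adjoint correction of [s]. *)
  pose (s' := fun b => eq_sym (s (f (g b))) @ (f_equal f (r (g b)) @ s b)).
  assert (coh : forall a, s' (f a) = f_equal f (r a)).
  { intro a. unfold s'. rewrite (homotopy_id_natural r a).
    assert (e : f_equal f (f_equal (fun a => g (f a)) (r a)) @ s (f a)
                = s (f (g (f a))) @ f_equal f (r a)).
    { destruct (r a). simpl. now rewrite eq_trans_refl_l. }
    rewrite e. apply eq_trans_sym_cancel. }
  intro b. exists (existT _ (g b) (s' b)).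
  intros [a p]. destruct p. rewrite coh.
  now destruct (r a).
Qed.

Definition equiv_of_inverse (A B : Type) (f : A -> B) (g : B -> A)
    (s : forall b, f (g b) = b) (r : forall a, g (f a) = a) : A <~> B :=
  existT _ f (is_equiv_of_inverse s r).

Definition inverse (A B : Type) (f : A -> B) (h : is_equiv f) (b : B) : A :=
  projT1 (projT1 (h b)).

Lemma inverse_section (A B : Type) (f : A -> B) (h : is_equiv f) (b : B) :
  f (inverse h b) = b.
Proof.
  exact (projT2 (projT1 (h b))).
Defined.

Lemma inverse_retraction (A B : Type) (f : A -> B) (h : is_equiv f) (a : A) :
  inverse h (f a) = a.
Proof.
  exact (f_equal (@projT1 _ _) (projT2 (h (f a)) (existT _ a eq_refl))).
Qed.

Definition equiv_sym (A B : Type) (e : A <~> B) : B <~> A :=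
  equiv_of_inverse (inverse_retraction (projT2 e)) (inverse_section (projT2 e)).

Lemma is_equiv_compose (A B C : Type) (f : A -> B) (g : B -> C) :
  is_equiv f -> is_equiv g -> is_equiv (fun a => g (f a)).
Proof.
  intros hf hg.
  apply (is_equiv_of_inverse (g := fun c => inverse hf (inverse hg c))).
  - intro c. now rewrite !inverse_section.
  - intro a. now rewrite !inverse_retraction.
Qed.

Definition equiv_trans (A B C : Type) (e : A <~> B) (e' : B <~> C) : A <~> C :=
  existT _ (fun a => projT1 e' (projT1 e a))
    (is_equiv_compose (projT2 e) (projT2 e')).

Lemma equiv_of_eq (A B : Type) : A = B -> A <~> B.
Proof.
  intro e. destruct e. apply equiv_id.
Qed.

Lemma equiv_eq_sym (A : Type) (x y : A) : (x = y) <~> (y = x).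
Proof.
  exact (equiv_of_inverse (@eq_sym_involutive A y x)
           (@eq_sym_involutive A x y)).
Qed.

Lemma is_equiv_pi (A : Type) (B C : A -> Type) (f : forall x, B x -> C x) :
  (forall x, is_equiv (f x)) ->
  is_equiv (fun (u : forall x, B x) x => f x (u x)).
Proof.
  intro h.
  apply (is_equiv_of_inverse
           (g := fun (v : forall x, C x) x => inverse (h x) (v x))).
  - intro v. apply functional_extensionality_dep. intro x.
    apply inverse_section.
  - intro u. apply functional_extensionality_dep. intro x.
    apply inverse_retraction.
Qed.

Definition equiv_pi (A : Type) (B C : A -> Type) (e : forall x, B x <~> C x) :
    (forall x, B x) <~> (forall x, C x) :=
  existT _ _ (is_equiv_pi (fun x => projT2 (e x))).

Lemma is_equiv_prod (A B A' B' : Type) (f : A -> A') (g : B -> B') :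
  is_equiv f -> is_equiv g ->
  is_equiv (fun u : A * B => (f (fst u), g (snd u))).
Proof.
  intros hf hg.
  apply (is_equiv_of_inverse
           (g := fun v => (inverse hf (fst v), inverse hg (snd v)))).
  - intros [a b]. simpl. now rewrite !inverse_section.
  - intros [a b]. simpl. now rewrite !inverse_retraction.
Qed.

Definition equiv_prod (A B A' B' : Type) (e : A <~> A') (e' : B <~> B') :
    A * B <~> A' * B' :=
  existT _ _ (is_equiv_prod (projT2 e) (projT2 e')).

(** The inverse transports along [f (inverse h b) = b].  For it to be a left inverse
    these paths have to be compatible with [inverse h (f a) = a], which holds as
    both come from the contraction of one fibre. *)
Lemma is_equiv_sigma_base (A B : Type) (f : A -> B) (P : B -> Type) :
  is_equiv f ->
  is_equiv (fun u : {a : A & P (f a)} => existT P (f (projT1 u)) (projT2 u)).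
Proof.
  intro h.
  apply (is_equiv_of_inverse
    (g := fun v : {b : B & P b} =>
       existT (fun a => P (f a)) (inverse h (projT1 v))
         (eq_rect _ P (projT2 v) _ (eq_sym (inverse_section h (projT1 v)))))).
  - intros [b p]. simpl. revert p. generalize (inverse_section h b).
    generalize (inverse h b). intros a q. now destruct q.
  - intros [a p]. simpl. unfold inverse, inverse_section.
    now rewrite (projT2 (h (f a)) (existT _ a eq_refl)).
Qed.

Lemma is_equiv_sigma_fibre (A : Type) (P Q : A -> Type)
    (f : forall a, P a -> Q a) :
  (forall a, is_equiv (f a)) ->
  is_equiv (fun u : {a : A & P a} => existT Q (projT1 u) (f _ (projT2 u))).
Proof.
  intro h.
  apply (is_equiv_of_inverse
    (g := fun v : {a : A & Q a} =>
       existT P (projT1 v) (inverse (h (projT1 v)) (projT2 v)))).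
  - intros [a q]. simpl. now rewrite inverse_section.
  - intros [a p]. simpl. now rewrite inverse_retraction.
Qed.

Definition equiv_sigma (A B : Type) (P : A -> Type) (Q : B -> Type)
    (e : A <~> B) (k : forall a, P a <~> Q (projT1 e a)) :
    {a : A & P a} <~> {b : B & Q b} :=
  equiv_trans (existT _ _ (is_equiv_sigma_fibre (fun a => projT2 (k a))))
    (existT _ _ (is_equiv_sigma_base (P := Q) (projT2 e))).

Lemma is_contr_equiv (A B : Type) : A <~> B -> is_contr B -> is_contr A.
Proof.
  intros e [b h]. exists (projT1 (equiv_sym e) b). intro a.
  simpl. rewrite (h (projT1 e a)). apply inverse_retraction.
Qed.

Lemma is_contr_based_paths (A : Type) (a : A) : is_contr {x : A & a = x}.
Proof.
  exists (existT _ a eq_refl). intros [x p]. now destruct p.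
Qed.

Lemma equiv_whisker_l (A : Type) (x y z : A) (p : x = y) (q r : y = z) :
  (q = r) <~> (p @ q = p @ r).
Proof.
  apply equiv_of_eq. destruct p. now rewrite !eq_trans_refl_l.
Qed.

(** * Families with contractible total space *)

Definition point (A : Type) (B : A -> Type) (h : is_contr {a : A & B a}) : A :=
  projT1 (projT1 h).

Definition elt (A : Type) (B : A -> Type) (h : is_contr {a : A & B a}) :
    B (point h) :=
  projT2 (projT1 h).

(** The path carried by an element of the family, first component of the
    contraction of the total space.  For horns, it turns a simplex into a path
    from the chosen filler to the missing face. *)
Definition to_path (A : Type) (B : A -> Type) (h : is_contr {a : A & B a})
    (a : A) (b : B a) : point h = a :=
  f_equal (@projT1 _ _) (projT2 h (existT _ a b)).

(** The contraction need not be constant at the centre, but a loop in a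
    contractible type is trivial. *)
Lemma to_path_elt (A : Type) (B : A -> Type) (h : is_contr {a : A & B a}) :
  to_path h (elt h) = eq_refl.
Proof.
  pose proof (is_prop_is_set (is_contr_is_prop h)) as k.
  destruct h as [[a b] h]. unfold to_path, elt, point. simpl.
  now rewrite (k _ _ (h (existT _ a b)) eq_refl).
Qed.

Lemma is_equiv_to_path (A : Type) (B : A -> Type)
    (h : is_contr {a : A & B a}) (a : A) :
  is_equiv (fun b : B a => to_path h b).
Proof.
  apply (is_equiv_of_inverse (g := fun p => eq_rect _ B (elt h) _ p)).
  - intro p. destruct p. apply to_path_elt.
  - assert (k : forall (u v : {a : A & B a}) (q : u = v),
               eq_rect _ B (projT2 u) _ (f_equal (@projT1 _ _) q) = projT2 v).
    { intros u v q. now destruct q. }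
    intro b. exact (k _ _ (projT2 h (existT B a b))).
Qed.

Definition equiv_to_path (A : Type) (B : A -> Type)
    (h : is_contr {a : A & B a}) (a : A) : B a <~> (point h = a) :=
  existT _ _ (@is_equiv_to_path A B h a).

(** The family being equivalent to the paths out of [point h], this is based path
    induction for it. *)
Lemma is_equiv_at_elt (A : Type) (B : A -> Type)
    (h : is_contr {a : A & B a}) (Q : forall a, B a -> Type) :
  is_equiv (fun F : forall a b, Q a b => F (point h) (elt h)).
Proof.
  pose proof (is_prop_is_set (is_contr_is_prop h)) as k.
  destruct h as [[c d] h]. unfold elt, point. simpl.
  apply (is_equiv_of_inverse
    (g := fun q a b => match h (existT _ a b) in _ = u
                       return Q (projT1 u) (projT2 u) with eq_refl => q end)).
  - intro q. now rewrite (k _ _ (h (existT _ c d)) eq_refl).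
  - intro F.
    assert (e : forall (u : {a : A & B a}) (q : existT _ c d = u),
               match q in _ = u return Q (projT1 u) (projT2 u) with
               | eq_refl => F c d
               end = F (projT1 u) (projT2 u)).
    { intros u q. now destruct q. }
    apply functional_extensionality_dep. intro a.
    apply functional_extensionality_dep. intro b.
    exact (e _ (h (existT _ a b))).
Qed.

Definition equiv_contract (A : Type) (B : A -> Type)
    (h : is_contr {a : A & B a}) (Q : forall a, B a -> Type) :
    (forall a b, Q a b) <~> Q (point h) (elt h) :=
  existT _ _ (@is_equiv_at_elt A B h Q).

Lemma contr_ind (A : Type) (B : A -> Type) (h : is_contr {a : A & B a})
    (Q : forall a, B a -> Type) : Q (point h) (elt h) -> forall a b, Q a b.
Proof.
  exact (inverse (@is_equiv_at_elt A B h Q)).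
Qed.

(** The paths [f a = f b], for varying [b], form a family with contractible total
    space, namely the fibre of [f] at [f a]. *)
Lemma equiv_ap (A B : Type) (f : A -> B) (h : is_equiv f) (a b : A) :
  (a = b) <~> (f a = f b).
Proof.
  assert (c : is_contr {b : A & f a = f b}).
  { refine (is_contr_equiv (equiv_sigma (e := equiv_id A) _) (h (f a))).
    intro x. apply equiv_eq_sym. }
  apply equiv_sym. refine (equiv_trans (equiv_to_path c b) _).
  apply equiv_of_eq. now rewrite (to_path c (eq_refl (f a))).
Qed.

Definition uniquely_filled (U : universe) (B : U) : Type :=
  {P : B -> U & is_contr {b : B & P b}}.

Lemma uniquely_filled_eq (U : universe) (B : U) (P Q : uniquely_filled B) :
  projT1 P = projT1 Q -> P = Q.
Proof.
  destruct P as [P h], Q as [Q k]. simpl. intro e. destruct e.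
  apply f_equal. apply is_prop_is_contr.
Qed.

(** The inverse sends [b] to the family of paths out of [b].  Univalence is used
    here, to identify any uniquely filled family with that one. *)
Definition equiv_uniquely_filled (U : universe) (ua : univalence U) (B : U) :
    uniquely_filled B <~> B.
Proof.
  refine (@equiv_of_inverse (uniquely_filled B) B (fun P => point (projT2 P))
    (fun b => existT _ (fun x => c_id b x)
       (is_contr_equiv
          (equiv_sigma (e := equiv_id _) (fun x => El_id b x))
          (is_contr_based_paths b))) _ _).
  - intro b. apply to_path. exact (inverse (projT2 (El_id b b)) eq_refl).
  - intros [P h]. apply uniquely_filled_eq.
    apply functional_extensionality_dep. intro x. apply (inverse (ua _ _)).
    exact (equiv_trans (El_id _ _) (equiv_sym (equiv_to_path h x))).
Defined.

(** * Level 2: composition from triangles *)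

(** Over fixed points, edges and identities, triangles with their fillings enter
    only through [P]; this makes extensionality applicable to them. *)
Definition segal2_of_filled (U : universe) (A0 : U) (A1 : A0 -> A0 -> U)
    (s : forall x, A1 x x)
    (P : forall x y z, A1 x y -> A1 y z -> uniquely_filled (A1 x z)) :
    semi_segal_deg_2 U :=
  {| ss_of_segal2 := {| A2 := fun x y z f h g => projT1 (P x y z f g) h |};
     segal2_fill2 := fun x y z f g => projT2 (P x y z f g);
     segal2_deg := s |}.

Lemma is_equiv_graph (U : universe) (ua : univalence U) :
  is_equiv (@graph_of_segal2 U).
Proof.
  pose (e := equiv_uniquely_filled ua).
  apply (is_equiv_of_inverse (g := fun G =>
    segal2_of_filled (@Id U G)
      (fun x y z f g => inverse (projT2 (e (Hom G x z))) (comp g f)))).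
  - intros [ob hom c i].
    refine (f_equal (fun c => {| comp := c; Id := i |}) (_ : _ = c)).
    do 5 (apply functional_extensionality_dep; intro).
    apply (inverse_section (projT2 (e _))).
  - intros [[a0 a1 a2] fill s].
    refine (f_equal (@segal2_of_filled U a0 a1 s)
      (_ : _ = fun x y z f g =>
         existT (fun P : a1 x z -> U => is_contr {h : a1 x z & P h})
           (fun h => a2 x y z f h g) (fill x y z f g))).
    do 5 (apply functional_extensionality_dep; intro).
    match goal with |- _ = ?P => exact (inverse_retraction (projT2 (e _)) P) end.
Qed.

(** * Level 3: associativity and unit laws from tetrahedra *)

Definition simplex_family_3 (U : universe) (X : semisimplicial_2 U) : Type :=
  forall (x0 x1 x2 x3 : A0 X)
    (x01 : A1 X x0 x1) (x02 : A1 X x0 x2) (x03 : A1 X x0 x3)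
    (x12 : A1 X x1 x2) (x13 : A1 X x1 x3) (x23 : A1 X x2 x3),
    A2 x01 x02 x12 -> A2 x01 x03 x13 -> A2 x02 x03 x23 -> A2 x12 x13 x23 -> U.

(** Functions sending every 3-horn to [R] of the type of its missing face.  With
    [R := El] it is a choice of missing faces, with [R := uniquely_filled] it is a
    family of 3-simplices with contractible horn filling. *)
Definition horns_3 (U : universe) (X : semisimplicial_2 U)
   (R : U -> Type) : Type :=
  forall (x0 x1 x2 x3 : A0 X)
    (x01 : A1 X x0 x1) (x02 : A1 X x0 x2) (x03 : A1 X x0 x3)
    (x12 : A1 X x1 x2) (x13 : A1 X x1 x3) (x23 : A1 X x2 x3)
    (x012 : A2 x01 x02 x12) (x013 : A2 x01 x03 x13) (x123 : A2 x12 x13 x23),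
    R (A2 x02 x03 x23).

Definition equiv_filled_3 (U : universe) (X : semisimplicial_2 U) :
    {A3 : simplex_family_3 X & has_horn_fillers_3 (Build_semisimplicial_3 A3)}
    <~> horns_3 X (@uniquely_filled U).
Proof.
  refine (equiv_of_inverse
    (f := fun (u : {A3 : simplex_family_3 X &
                    has_horn_fillers_3 (Build_semisimplicial_3 A3)})
              x0 x1 x2 x3 x01 x02 x03 x12 x13 x23 x012 x013 x123 =>
       existT
         (fun P : A2 x02 x03 x23 -> U => is_contr {b : A2 x02 x03 x23 & P b})
         (fun x023 => projT1 u x0 x1 x2 x3 x01 x02 x03 x12 x13 x23
                        x012 x013 x023 x123)
         (projT2 u x0 x1 x2 x3 x01 x02 x03 x12 x13 x23 x012 x013 x123))
    (g := fun v => existT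
       (fun A3 => has_horn_fillers_3 (Build_semisimplicial_3 A3))
       (fun x0 x1 x2 x3 x01 x02 x03 x12 x13 x23 x012 x013 x023 x123 =>
          projT1 (v x0 x1 x2 x3 x01 x02 x03 x12 x13 x23 x012 x013 x123) x023)
       (fun x0 x1 x2 x3 x01 x02 x03 x12 x13 x23 x012 x013 x123 =>
          projT2 (v x0 x1 x2 x3 x01 x02 x03 x12 x13 x23 x012 x013 x123)))
    _ _).
  - intro v. do 13 (apply functional_extensionality_dep; intro).
    simpl. now destruct (v _ _ _ _ _ _ _ _ _ _ _ _ _).
  - intros [A3 fill]. reflexivity.
Defined.

Definition equiv_fillers_3 (U : universe) (ua : univalence U)
    (X : semisimplicial_2 U) :
    horns_3 X (@uniquely_filled U) <~> horns_3 X (@El U).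
Proof.
  do 13 (apply equiv_pi; intro). apply (equiv_uniquely_filled ua).
Defined.

Definition composite (U : universe) (X : semisimplicial_2 U)
    (h : has_horn_fillers_2 X) (x y z : A0 X) (f : A1 X x y) (g : A1 X y z) :
    A1 X x z :=
  point (h x y z f g).

Definition composition_triangle (U : universe) (X : semisimplicial_2 U)
    (h : has_horn_fillers_2 X) (x y z : A0 X) (f : A1 X x y) (g : A1 X y z) :
    A2 f (composite h f g) g :=
  elt (h x y z f g).

Definition associator (U : universe) (X : semisimplicial_2 U)
    (h : has_horn_fillers_2 X) : Type :=
  forall (x y z w : A0 X) (f : A1 X x y) (g : A1 X y z) (k : A1 X z w),
    composite h (composite h f g) k = composite h f (composite h g k).

(** The 3-horn on three composable edges whose triangles are composition
    triangles has a missing face that relates the two iterated composites. *)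
Definition associator_of_filler (U : universe) (X : semisimplicial_2 U)
    (h : has_horn_fillers_2 X) (F : horns_3 X (@El U)) : associator h :=
  fun x y z w f g k =>
    to_path (h _ _ _ (composite h f g) k)
      (F x y z w f _ _ g _ k (composition_triangle h f g)
         (composition_triangle h f (composite h g k))
         (composition_triangle h g k)).

(** Nothing is lost: a 3-horn is given by three composable edges and by triangles
    over the composable pairs [(x01, x12)], [(x12, x23)] and [(x01, x13)], all of
    which may be contracted to composition triangles. *)
Definition equiv_associator (U : universe) (X : semisimplicial_2 U)
    (h : has_horn_fillers_2 X) : horns_3 X (@El U) <~> associator h.
Proof.
  eapply equiv_trans.
  - refine (@equiv_of_inverse (horns_3 X (@El U))
      (forall x0 x1 x2 x3 (x01 : A1 X x0 x1) (x12 : A1 X x1 x2)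
          (x23 : A1 X x2 x3) x02 (x012 : A2 x01 x02 x12)
          x13 (x123 : A2 x12 x13 x23) x03 (x013 : A2 x01 x03 x13),
          A2 x02 x03 x23)
      (fun F x0 x1 x2 x3 x01 x12 x23 x02 x012 x13 x123 x03 x013 =>
         F x0 x1 x2 x3 x01 x02 x03 x12 x13 x23 x012 x013 x123)
      (fun F x0 x1 x2 x3 x01 x02 x03 x12 x13 x23 x012 x013 x123 =>
         F x0 x1 x2 x3 x01 x12 x23 x02 x012 x13 x123 x03 x013)
      (fun _ => eq_refl) (fun _ => eq_refl)).
  - (* The order of the arguments lets each pair of an edge and a triangle be
       contracted in turn: [x13] has to precede [x03]. *)
    do 7 (apply equiv_pi; intro).
    do 3 (eapply equiv_trans; [apply (equiv_contract (h _ _ _ _ _)) |]).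
    apply (equiv_to_path (h _ _ _ _ _)).
Defined.

Definition missing_faces_3 (U : universe) (X : semisimplicial_3 U)
    (h : has_horn_fillers_3 X) : horns_3 X (@El U) :=
  fun x0 x1 x2 x3 x01 x02 x03 x12 x13 x23 x012 x013 x123 =>
    point (h x0 x1 x2 x3 x01 x02 x03 x12 x13 x23 x012 x013 x123).

Definition precat_of_segal3 (U : universe) (X : semi_segal_deg_3 U) :
    wild_precategory U :=
  {| graph_of_precat :=
       semi_segal_graph (segal3_fill2 X) (s00 (segal3_deg X));
     assoc :=
       @associator_of_filler U X (segal3_fill2 X)
         (missing_faces_3 (@segal3_fill3 U X));
     unit_l := fun x y f =>
       to_path (segal3_fill2 X _ _ _ f _) (s11 (segal3_deg X) f);
     unit_r := fun x y f =>
       to_path (segal3_fill2 X _ _ _ _ f) (s10 (segal3_deg X) f) |}.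

Definition extension_3 (U : universe) (X : semi_segal_deg_2 U) : Type :=
  ({A3 : simplex_family_3 X & has_horn_fillers_3 (Build_semisimplicial_3 A3)}
   * ((forall x y (f : A1 X x y), A2 (segal2_deg X x) f f)
      * (forall x y (f : A1 X x y), A2 f f (segal2_deg X y))))%type.

Definition restriction_3 (U : universe) (X : semi_segal_deg_3 U) :
    semi_segal_deg_2 U :=
  {| segal2_fill2 := segal3_fill2 X; segal2_deg := s00 (segal3_deg X) |}.

Definition extension_of_segal3 (U : universe) (X : semi_segal_deg_3 U) :
    extension_3 (restriction_3 X) :=
  (existT (fun A3 : simplex_family_3 X =>
             has_horn_fillers_3 (Build_semisimplicial_3 A3))
     (@A3 U X) (@segal3_fill3 U X),
   (@s10 U X (segal3_deg X), @s11 U X (segal3_deg X))).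

Definition segal3_of_extension (U : universe) (X : semi_segal_deg_2 U)
    (e : extension_3 X) : semi_segal_deg_3 U :=
  {| ss_of_segal3 := {| A3 := projT1 (fst e) |};
     segal3_fill2 := segal2_fill2 X;
     segal3_fill3 := projT2 (fst e);
     segal3_deg := {| s00 := segal2_deg X; s10 := fst (snd e);
                      s11 := snd (snd e) |} |}.

Lemma extension_of_segal3_of_extension (U : universe) (X : semi_segal_deg_2 U)
    (e : extension_3 X) : extension_of_segal3 (segal3_of_extension e) = e.
Proof.
  destruct e as [[A3 fill] [r l]]. reflexivity.
Qed.

Definition equiv_extension_3 (U : universe) :
    semi_segal_deg_3 U <~> {X : semi_segal_deg_2 U & extension_3 X}.
Proof.
  refine (@equiv_of_inverse (semi_segal_deg_3 U)
    {X : semi_segal_deg_2 U & extension_3 X}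
    (fun X => existT _ (restriction_3 X) (extension_of_segal3 X))
    (fun u => segal3_of_extension (projT2 u)) _ _).
  - intros [X e].
    exact (f_equal (existT _ X) (extension_of_segal3_of_extension e)).
  - reflexivity.
Defined.

Definition coherence_3 (U : universe) (G : rt_graph U) : Type :=
  ((forall x y z w (f : Hom G x y) (g : Hom G y z) (h : Hom G z w),
      h ∘ (g ∘ f) = (h ∘ g) ∘ f)
   * ((forall x y (f : Hom G x y), f ∘ Id x = f)
      * (forall x y (f : Hom G x y), Id y ∘ f = f)))%type.

Definition coherence_of_precat (U : universe) (C : wild_precategory U) :
    coherence_3 C :=
  (@assoc U C, (@unit_r U C, @unit_l U C)).

Definition precat_of_coherence (U : universe) (G : rt_graph U)
    (e : coherence_3 G) : wild_precategory U :=
  {| assoc := fst e; unit_r := fst (snd e); unit_l := snd (snd e) |}.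

Lemma coherence_of_precat_of_coherence (U : universe) (G : rt_graph U)
    (e : coherence_3 G) : coherence_of_precat (precat_of_coherence e) = e.
Proof.
  destruct e as [a [r l]]. reflexivity.
Qed.

Definition equiv_coherence_3 (U : universe) :
    {G : rt_graph U & coherence_3 G} <~> wild_precategory U.
Proof.
  refine (@equiv_of_inverse {G : rt_graph U & coherence_3 G}
    (wild_precategory U)
    (fun u => precat_of_coherence (projT2 u))
    (fun C => existT _ (graph_of_precat C) (coherence_of_precat C)) _ _).
  - reflexivity.
  - intros [G e].
    exact (f_equal (existT _ G) (coherence_of_precat_of_coherence e)).
Defined.

Definition equiv_extension_coherence_3 (U : universe) (ua : univalence U)
    (X : semi_segal_deg_2 U) :
    extension_3 X <~> coherence_3 (graph_of_segal2 X).
Proof.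
  apply equiv_prod; [| apply equiv_prod].
  - eapply equiv_trans; [apply equiv_filled_3 |].
    eapply equiv_trans; [apply (equiv_fillers_3 ua) |].
    apply (equiv_associator (segal2_fill2 X)).
  - do 3 (apply equiv_pi; intro).
    apply (equiv_to_path (segal2_fill2 X _ _ _ _ _)).
  - do 3 (apply equiv_pi; intro).
    apply (equiv_to_path (segal2_fill2 X _ _ _ _ _)).
Defined.

(** The composite of the three equivalences computes to [precat_of_segal3], whose
    explicit form the next level and the comparison of univalence rely on. *)
Lemma is_equiv_precat (U : universe) (ua : univalence U) :
  is_equiv (@precat_of_segal3 U).
Proof.
  exact (projT2 (equiv_trans (equiv_extension_3 U)
    (equiv_trans
      (equiv_sigma (e := existT _ _ (is_equiv_graph ua))
         (equiv_extension_coherence_3 ua))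
      (equiv_coherence_3 U)))).
Qed.

(** * Univalence of a wild precategory *)

(** Composition with an isomorphism is an equivalence on either side, so left and
    right inverses are points of contractible fibres. *)
Lemma is_prop_is_iso (U : universe) (C : wild_precategory U) (x y : Ob C)
    (f : Hom C x y) : is_prop (is_iso f).
Proof.
  intros i j.
  assert (inv : {k : Hom C y x & ((k ∘ f = Id x) * (f ∘ k = Id y))%type}).
  { destruct i as [[k kf] [l fl]]. exists l. split; [| exact fl].
    assert (e : l = k).
    { now rewrite <- (unit_l l), <- kf, <- assoc, fl, unit_r. }
    now rewrite e. }
  destruct inv as [k [kf fk]].
  assert (left : is_equiv (fun g : Hom C y x => g ∘ f)).
  { apply (is_equiv_of_inverse (g := fun h => h ∘ k)).
    - intro h. now rewrite <- assoc, kf, unit_r.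
    - intro h. now rewrite <- assoc, fk, unit_r. }
  assert (right : is_equiv (fun g : Hom C y x => f ∘ g)).
  { apply (is_equiv_of_inverse (g := fun h => k ∘ h)).
    - intro h. now rewrite assoc, fk, unit_l.
    - intro h. now rewrite assoc, kf, unit_l. }
  destruct i as [i1 i2], j as [j1 j2].
  now rewrite (is_contr_is_prop (left _) i1 j1),
              (is_contr_is_prop (right _) i2 j2).
Qed.

(** A semi-Segal type shows [Id ∘ Id = Id] by the right unit law, a wild
    precategory by the left one; univalence does not see the difference. *)
Lemma equiv_is_univalent (U : universe) (C : wild_precategory U)
    (e e' : id_idempotent C) : is_univalent e <~> is_univalent e'.
Proof.
  do 2 (apply equiv_pi; intro). apply equiv_of_eq. apply f_equal.
  apply functional_extensionality_dep. intro p. destruct p.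
  exact (f_equal (existT _ (Id x)) (is_prop_is_iso _ _)).
Qed.

(** * Tetrahedra as equations between paths *)

Definition triangle_path (U : universe) (X : semi_segal_deg_3 U)
    (x y z : A0 X) (f : A1 X x y) (h : A1 X x z) (g : A1 X y z)
    (t : A2 f h g) : comp (r := precat_of_segal3 X) g f = h :=
  to_path (segal3_fill2 X x y z f g) t.

Lemma triangle_path_elt (U : universe) (X : semi_segal_deg_3 U)
    (x y z : A0 X) (f : A1 X x y) (g : A1 X y z) :
  triangle_path (elt (segal3_fill2 X x y z f g)) = eq_refl.
Proof.
  apply to_path_elt.
Qed.

(** The missing face of an arbitrary 3-horn, in terms of the associator: by
    contraction of the three given triangles, it need only be compared with the
    definition of the associator. *)
Lemma filler_path (U : universe) (X : semi_segal_deg_3 U)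
    (x0 x1 x2 x3 : A0 X)
    (x01 : A1 X x0 x1) (x02 : A1 X x0 x2) (x03 : A1 X x0 x3)
    (x12 : A1 X x1 x2) (x13 : A1 X x1 x3) (x23 : A1 X x2 x3)
    (x012 : A2 x01 x02 x12) (x013 : A2 x01 x03 x13) (x123 : A2 x12 x13 x23) :
  f_equal (fun t => comp (r := precat_of_segal3 X) x23 t) (triangle_path x012)
    @ triangle_path (point (@segal3_fill3 U X _ _ _ _ _ _ _ _ _ _ x012 x013 x123))
  = @assoc U (precat_of_segal3 X) x0 x1 x2 x3 x01 x12 x23
    @ f_equal (fun t => comp (r := precat_of_segal3 X) t x01)
        (triangle_path x123)
    @ triangle_path x013.
Proof.
  revert x02 x012 x13 x123 x03 x013.
  do 3 refine (contr_ind (h := segal3_fill2 X _ _ _ _ _) (Q := fun f t => _) _).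
  rewrite !triangle_path_elt. apply eq_trans_refl_l.
Qed.

(** Both sides of the equation are paths from [x23 ∘ (x12 ∘ x01)] to [x03]: one
    goes through [x13], the other through [x02].  A tetrahedron identifies the
    face opposite to [x1] with the missing face chosen by the filler, and
    [filler_path] computes the latter. *)
Lemma equiv_tetrahedron (U : universe) (X : semi_segal_deg_3 U)
    (x0 x1 x2 x3 : A0 X)
    (x01 : A1 X x0 x1) (x02 : A1 X x0 x2) (x03 : A1 X x0 x3)
    (x12 : A1 X x1 x2) (x13 : A1 X x1 x3) (x23 : A1 X x2 x3)
    (x012 : A2 x01 x02 x12) (x013 : A2 x01 x03 x13) (x023 : A2 x02 x03 x23)
    (x123 : A2 x12 x13 x23) :
  A3 x012 x013 x023 x123 <~>
  (@assoc U (precat_of_segal3 X) x0 x1 x2 x3 x01 x12 x23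
     @ f_equal (fun t => comp (r := precat_of_segal3 X) t x01)
         (triangle_path x123)
     @ triangle_path x013
   = f_equal (fun t => comp (r := precat_of_segal3 X) x23 t)
       (triangle_path x012)
     @ triangle_path x023).
Proof.
  eapply equiv_trans;
    [apply (equiv_to_path
       (@segal3_fill3 U X _ _ _ _ _ _ _ _ _ _ x012 x013 x123)) |].
  eapply equiv_trans;
    [apply (equiv_ap (@is_equiv_to_path _ _ (segal3_fill2 X _ _ _ _ _) _)) |].
  eapply equiv_trans;
    [apply (equiv_whisker_l
       (f_equal (fun t => comp (r := precat_of_segal3 X) x23 t)
          (triangle_path x012))) |].
  apply equiv_of_eq. now rewrite <- (filler_path x012 x013 x123).
Qed.

Lemma filler_path_elt (U : universe) (X : semi_segal_deg_3 U)
    (x0 x1 x2 x3 : A0 X)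
    (x01 : A1 X x0 x1) (x12 : A1 X x1 x2) (x13 : A1 X x1 x3) (x23 : A1 X x2 x3)
    (x123 : A2 x12 x13 x23) :
  triangle_path
    (point (@segal3_fill3 U X _ _ _ _ _ _ _ _ _ _
              (elt (segal3_fill2 X _ _ _ x01 x12))
              (elt (segal3_fill2 X _ _ _ x01 x13)) x123))
  = @assoc U (precat_of_segal3 X) x0 x1 x2 x3 x01 x12 x23
    @ f_equal (fun t => comp (r := precat_of_segal3 X) t x01)
        (triangle_path x123).
Proof.
  pose proof (filler_path (elt (segal3_fill2 X _ _ _ x01 x12))
    (elt (segal3_fill2 X _ _ _ x01 x13)) x123) as e.
  rewrite !triangle_path_elt in e. simpl in e.
  now rewrite eq_trans_refl_l in e.
Qed.

(** * Level 4: pentagonator and triangle laws from 4-simplices *)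

Definition simplex_family_4 (U : universe) (X : semisimplicial_3 U) : Type :=
  forall (x0 x1 x2 x3 x4 : A0 X)
    (x01 : A1 X x0 x1) (x02 : A1 X x0 x2) (x03 : A1 X x0 x3)
    (x04 : A1 X x0 x4) (x12 : A1 X x1 x2) (x13 : A1 X x1 x3)
    (x14 : A1 X x1 x4) (x23 : A1 X x2 x3) (x24 : A1 X x2 x4)
    (x34 : A1 X x3 x4)
    (x012 : A2 x01 x02 x12) (x013 : A2 x01 x03 x13) (x014 : A2 x01 x04 x14)
    (x023 : A2 x02 x03 x23) (x024 : A2 x02 x04 x24) (x034 : A2 x03 x04 x34)
    (x123 : A2 x12 x13 x23) (x124 : A2 x12 x14 x24) (x134 : A2 x13 x14 x34)
    (x234 : A2 x23 x24 x34),
    A3 x012 x013 x023 x123 -> A3 x012 x014 x024 x124 ->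
    A3 x013 x014 x034 x134 -> A3 x023 x024 x034 x234 ->
    A3 x123 x124 x134 x234 -> U.

Definition horns_4 (U : universe) (X : semisimplicial_3 U)
    (R : U -> Type) : Type :=
  forall (x0 x1 x2 x3 x4 : A0 X)
    (x01 : A1 X x0 x1) (x02 : A1 X x0 x2) (x03 : A1 X x0 x3)
    (x04 : A1 X x0 x4) (x12 : A1 X x1 x2) (x13 : A1 X x1 x3)
    (x14 : A1 X x1 x4) (x23 : A1 X x2 x3) (x24 : A1 X x2 x4)
    (x34 : A1 X x3 x4)
    (x012 : A2 x01 x02 x12) (x013 : A2 x01 x03 x13) (x014 : A2 x01 x04 x14)
    (x023 : A2 x02 x03 x23) (x024 : A2 x02 x04 x24) (x034 : A2 x03 x04 x34)
    (x123 : A2 x12 x13 x23) (x124 : A2 x12 x14 x24) (x134 : A2 x13 x14 x34)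
    (x234 : A2 x23 x24 x34)
    (x0123 : A3 x012 x013 x023 x123) (x0124 : A3 x012 x014 x024 x124)
    (x0134 : A3 x013 x014 x034 x134) (x1234 : A3 x123 x124 x134 x234),
    R (A3 x023 x024 x034 x234).

Lemma equiv_filled_4 (U : universe) (X : semisimplicial_3 U) :
  {A4 : simplex_family_4 X & has_horn_fillers_4 (Build_semisimplicial_4 A4)}
  <~> horns_4 X (@uniquely_filled U).
Proof.
  refine (@equiv_of_inverse
    {A4 : simplex_family_4 X & has_horn_fillers_4 (Build_semisimplicial_4 A4)}
    (horns_4 X (@uniquely_filled U))
    (fun u x0 x1 x2 x3 x4 x01 x02 x03 x04 x12 x13 x14 x23 x24 x34
         x012 x013 x014 x023 x024 x034 x123 x124 x134 x234
         x0123 x0124 x0134 x1234 =>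
       existT _
         (fun x0234 => projT1 u x0 x1 x2 x3 x4
            x01 x02 x03 x04 x12 x13 x14 x23 x24 x34
            x012 x013 x014 x023 x024 x034 x123 x124 x134 x234
            x0123 x0124 x0134 x0234 x1234)
         (projT2 u x0 x1 x2 x3 x4 x01 x02 x03 x04 x12 x13 x14 x23 x24 x34
            x012 x013 x014 x023 x024 x034 x123 x124 x134 x234
            x0123 x0124 x0134 x1234))
    (fun v => existT
       (fun A4 => has_horn_fillers_4 (Build_semisimplicial_4 A4))
       (fun x0 x1 x2 x3 x4 x01 x02 x03 x04 x12 x13 x14 x23 x24 x34
            x012 x013 x014 x023 x024 x034 x123 x124 x134 x234
            x0123 x0124 x0134 x0234 x1234 =>
          projT1 (v x0 x1 x2 x3 x4 x01 x02 x03 x04 x12 x13 x14 x23 x24 x34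
            x012 x013 x014 x023 x024 x034 x123 x124 x134 x234
            x0123 x0124 x0134 x1234) x0234)
       (fun x0 x1 x2 x3 x4 x01 x02 x03 x04 x12 x13 x14 x23 x24 x34
            x012 x013 x014 x023 x024 x034 x123 x124 x134 x234
            x0123 x0124 x0134 x1234 =>
          projT2 (v x0 x1 x2 x3 x4 x01 x02 x03 x04 x12 x13 x14 x23 x24 x34
            x012 x013 x014 x023 x024 x034 x123 x124 x134 x234
            x0123 x0124 x0134 x1234)))
    _ _).
  - intro v. do 29 (apply functional_extensionality_dep; intro).
    simpl. now destruct (v _ _ _ _ _ _ _ _ _ _ _ _ _ _ _
      _ _ _ _ _ _ _ _ _ _ _ _ _ _).
  - intros [A4 fill]. reflexivity.
Qed.

Lemma equiv_fillers_4 (U : universe) (ua : univalence U)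
    (X : semisimplicial_3 U) :
  horns_4 X (@uniquely_filled U) <~> horns_4 X (@El U).
Proof.
  do 29 (apply equiv_pi; intro). apply (equiv_uniquely_filled ua).
Qed.

Definition pentagon (U : universe) (C : wild_precategory U) : Type :=
  forall (a b c d e : Ob C)
    (f : Hom C a b) (g : Hom C b c) (h : Hom C c d) (k : Hom C d e),
    f_equal (fun t => k ∘ t) (assoc f g h) @ assoc f (h ∘ g) k
      @ f_equal (fun t => t ∘ f) (assoc g h k)
    = assoc (g ∘ f) h k @ assoc f g (k ∘ h).

(** A 4-horn on four composable edges is determined by them: six of its triangles
    and four of its tetrahedra may be contracted.  The faces of the missing
    tetrahedron are then a composition triangle and missing faces of 3-horns; by
    [filler_path_elt] the paths of the latter are made of associators, and
    [equiv_tetrahedron] yields the pentagon. *)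
Lemma equiv_pentagon (U : universe) (X : semi_segal_deg_3 U) :
  horns_4 X (@El U) <~> pentagon (precat_of_segal3 X).
Proof.
  eapply equiv_trans.
  - refine (@equiv_of_inverse (horns_4 X (@El U))
      (forall x0 x1 x2 x3 x4 (x01 : A1 X x0 x1) (x12 : A1 X x1 x2)
          (x23 : A1 X x2 x3) (x34 : A1 X x3 x4)
          x02 (x012 : A2 x01 x02 x12) x13 (x123 : A2 x12 x13 x23)
          x24 (x234 : A2 x23 x24 x34) x03 (x013 : A2 x01 x03 x13)
          x14 (x124 : A2 x12 x14 x24) x04 (x014 : A2 x01 x04 x14)
          x023 (x0123 : A3 x012 x013 x023 x123)
          x024 (x0124 : A3 x012 x014 x024 x124)
          x134 (x1234 : A3 x123 x124 x134 x234)
          x034 (x0134 : A3 x013 x014 x034 x134),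
          A3 x023 x024 x034 x234)
      (fun F x0 x1 x2 x3 x4 x01 x12 x23 x34
           x02 x012 x13 x123 x24 x234 x03 x013 x14 x124 x04 x014
           x023 x0123 x024 x0124 x134 x1234 x034 x0134 =>
         F x0 x1 x2 x3 x4 x01 x02 x03 x04 x12 x13 x14 x23 x24 x34
           x012 x013 x014 x023 x024 x034 x123 x124 x134 x234
           x0123 x0124 x0134 x1234)
      (fun F x0 x1 x2 x3 x4 x01 x02 x03 x04 x12 x13 x14 x23 x24 x34
           x012 x013 x014 x023 x024 x034 x123 x124 x134 x234
           x0123 x0124 x0134 x1234 =>
         F x0 x1 x2 x3 x4 x01 x12 x23 x34
           x02 x012 x13 x123 x24 x234 x03 x013 x14 x124 x04 x014
           x023 x0123 x024 x0124 x134 x1234 x034 x0134)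
      (fun _ => eq_refl) (fun _ => eq_refl)).
  - (* [x134] has to precede [x034], as it belongs to the 3-horn of [x034]. *)
    do 9 (apply equiv_pi; intro).
    do 6 (eapply equiv_trans;
            [apply (equiv_contract (segal3_fill2 X _ _ _ _ _)) |]).
    do 4 (eapply equiv_trans;
            [apply (equiv_contract
                      (@segal3_fill3 U X _ _ _ _ _ _ _ _ _ _ _ _ _)) |]).
    eapply equiv_trans; [apply equiv_tetrahedron |].
    eapply equiv_trans; [apply equiv_eq_sym |]. apply equiv_of_eq.
    now rewrite !filler_path_elt, !triangle_path_elt, eq_trans_assoc.
Qed.

Definition extension_4 (U : universe) (X : semi_segal_deg_3 U) : Type :=
  let s := segal3_deg X in
  ({A4 : simplex_family_4 X & has_horn_fillers_4 (Build_semisimplicial_4 A4)}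
   * ((forall x0 x1 x2 (x01 : A1 X x0 x1) x02 (x12 : A1 X x1 x2)
          (x012 : A2 x01 x02 x12), A3 (s10 s x01) (s10 s x02) x012 x012)
      * ((forall x0 x1 x2 (x01 : A1 X x0 x1) x02 (x12 : A1 X x1 x2)
            (x012 : A2 x01 x02 x12), A3 (s11 s x01) x012 x012 (s10 s x12))
         * (forall x0 x1 x2 (x01 : A1 X x0 x1) x02 (x12 : A1 X x1 x2)
            (x012 : A2 x01 x02 x12), A3 x012 x012 (s11 s x02) (s11 s x12)))))%type.

Definition coherence_4 (U : universe) (C : wild_precategory U) : Type :=
  (pentagon C
   * ((forall (x y z : Ob C) (f : Hom C x y) (g : Hom C y z),
         f_equal (fun t => g ∘ t) (unit_r f)
         = assoc (Id x) f g @ unit_r (g ∘ f))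
      * ((forall (x y z : Ob C) (f : Hom C x y) (g : Hom C y z),
            f_equal (fun t => g ∘ t) (unit_l f)
            = assoc f (Id y) g @ f_equal (fun t => t ∘ f) (unit_r g))
         * (forall (x y z : Ob C) (f : Hom C x y) (g : Hom C y z),
              unit_l (g ∘ f)
              = assoc f g (Id z) @ f_equal (fun t => t ∘ f) (unit_l g)))))%type.

Lemma equiv_forall_triangle (U : universe) (X : semi_segal_deg_3 U)
    (R : forall (x0 x1 x2 : A0 X) (x01 : A1 X x0 x1) x02 (x12 : A1 X x1 x2),
       A2 x01 x02 x12 -> U) :
  (forall x0 x1 x2 (x01 : A1 X x0 x1) x02 (x12 : A1 X x1 x2)
     (x012 : A2 x01 x02 x12), R x0 x1 x2 x01 x02 x12 x012)
  <~> (forall x0 x1 x2 (x01 : A1 X x0 x1) (x12 : A1 X x1 x2),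
         R x0 x1 x2 x01 _ x12 (elt (segal3_fill2 X x0 x1 x2 x01 x12))).
Proof.
  eapply equiv_trans.
  - refine (@equiv_of_inverse _
      (forall x0 x1 x2 (x01 : A1 X x0 x1) (x12 : A1 X x1 x2) x02
            (x012 : A2 x01 x02 x12), R x0 x1 x2 x01 x02 x12 x012)
      (fun F x0 x1 x2 x01 x12 x02 => F x0 x1 x2 x01 x02 x12)
      (fun F x0 x1 x2 x01 x02 x12 => F x0 x1 x2 x01 x12 x02)
      (fun _ => eq_refl) (fun _ => eq_refl)).
  - do 5 (apply equiv_pi; intro).
    refine (equiv_contract (segal3_fill2 X _ _ _ _ _)
              (fun f t => R _ _ _ _ f _ t)).
Qed.

(** The tetrahedra [s20], [s21] and [s22] on a composition triangle have two faces
    with trivial paths; their other two faces are degenerate triangles, whose paths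
    are the unit laws.  Their equations are the three triangle laws. *)
Lemma equiv_extension_coherence_4 (U : universe) (ua : univalence U)
    (X : semi_segal_deg_3 U) :
  extension_4 X <~> coherence_4 (precat_of_segal3 X).
Proof.
  apply equiv_prod; [| apply equiv_prod; [| apply equiv_prod]].
  - eapply equiv_trans; [apply equiv_filled_4 |].
    eapply equiv_trans; [apply (equiv_fillers_4 ua) |].
    apply equiv_pentagon.
  - eapply equiv_trans; [apply (equiv_forall_triangle (X := X)) |].
    do 5 (apply equiv_pi; intro).
    eapply equiv_trans; [apply equiv_tetrahedron |].
    eapply equiv_trans; [apply equiv_eq_sym |]. apply equiv_of_eq.
    now rewrite !triangle_path_elt.
  - eapply equiv_trans; [apply (equiv_forall_triangle (X := X)) |].
    do 5 (apply equiv_pi; intro).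
    eapply equiv_trans; [apply equiv_tetrahedron |].
    eapply equiv_trans; [apply equiv_eq_sym |]. apply equiv_of_eq.
    now rewrite !triangle_path_elt.
  - eapply equiv_trans; [apply (equiv_forall_triangle (X := X)) |].
    do 5 (apply equiv_pi; intro).
    eapply equiv_trans; [apply equiv_tetrahedron |].
    eapply equiv_trans; [apply equiv_eq_sym |]. apply equiv_of_eq.
    rewrite !triangle_path_elt. simpl. now rewrite eq_trans_refl_l.
Qed.

Definition restriction_4 (U : universe) (X : semi_segal_deg_4 U) :
    semi_segal_deg_3 U :=
  {| segal3_fill2 := segal4_fill2 X; segal3_fill3 := @segal4_fill3 U X;
     segal3_deg := segal4_deg X |}.

Definition extension_of_segal4 (U : universe) (X : semi_segal_deg_4 U) :
    extension_4 (restriction_4 X) :=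
  (existT (fun A4 : simplex_family_4 X =>
             has_horn_fillers_4 (Build_semisimplicial_4 A4))
     (@A4 U X) (@segal4_fill4 U X),
   (@s20 U X (segal4_deg X),
    (@s21 U X (segal4_deg X), @s22 U X (segal4_deg X)))).

Definition segal4_of_extension (U : universe) (X : semi_segal_deg_3 U)
    (e : extension_4 X) : semi_segal_deg_4 U :=
  {| ss_of_segal4 := {| A4 := projT1 (fst e) |};
     segal4_fill2 := segal3_fill2 X;
     segal4_fill3 := @segal3_fill3 U X;
     segal4_fill4 := projT2 (fst e);
     segal4_deg := {| s20 := fst (snd e); s21 := fst (snd (snd e));
                      s22 := snd (snd (snd e)) |} |}.

Lemma extension_of_segal4_of_extension (U : universe) (X : semi_segal_deg_3 U)
    (e : extension_4 X) : extension_of_segal4 (segal4_of_extension e) = e.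
Proof.
  destruct e as [[A4 fill] [s [t r]]]. reflexivity.
Qed.

Definition equiv_extension_4 (U : universe) :
    semi_segal_deg_4 U <~> {X : semi_segal_deg_3 U & extension_4 X}.
Proof.
  refine (@equiv_of_inverse (semi_segal_deg_4 U)
    {X : semi_segal_deg_3 U & extension_4 X}
    (fun X => existT _ (restriction_4 X) (extension_of_segal4 X))
    (fun u => segal4_of_extension (projT2 u)) _ _).
  - intros [X e].
    exact (f_equal (existT _ X) (extension_of_segal4_of_extension e)).
  - reflexivity.
Defined.

Definition coherence_of_2precat (U : universe) (C : wild_2precategory U) :
    coherence_4 C :=
  (@pentagonator U C, (@triangle_2 U C, (@triangle_1 U C, @triangle_0 U C))).

Definition two_precat_of_coherence (U : universe) (C : wild_precategory U)
    (e : coherence_4 C) : wild_2precategory U :=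
  {| pentagonator := fst e; triangle_2 := fst (snd e);
     triangle_1 := fst (snd (snd e)); triangle_0 := snd (snd (snd e)) |}.

Lemma coherence_of_2precat_of_coherence (U : universe) (C : wild_precategory U)
    (e : coherence_4 C) : coherence_of_2precat (two_precat_of_coherence e) = e.
Proof.
  destruct e as [p [t2 [t1 t0]]]. reflexivity.
Qed.

Definition equiv_coherence_4 (U : universe) :
    {C : wild_precategory U & coherence_4 C} <~> wild_2precategory U.
Proof.
  refine (@equiv_of_inverse {C : wild_precategory U & coherence_4 C}
    (wild_2precategory U)
    (fun u => two_precat_of_coherence (projT2 u))
    (fun C => existT _ (precat_of_2precat C) (coherence_of_2precat C)) _ _).
  - reflexivity.
  - intros [C e].
    exact (f_equal (existT _ C) (coherence_of_2precat_of_coherence e)).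
Defined.

Definition equiv_2precat (U : universe) (ua : univalence U) :
    semi_segal_deg_4 U <~> wild_2precategory U :=
  equiv_trans (equiv_extension_4 U)
    (equiv_trans
       (equiv_sigma (e := existT _ _ (is_equiv_precat ua))
          (equiv_extension_coherence_4 ua))
       (equiv_coherence_4 U)).

(** * The three equivalences *)

Lemma equiv_poset_semi_segal_set (U : universe) (ua : univalence U) :
  poset U <~> univalent_semi_segal_set U.
Proof.
  pose (T := fun G : rt_graph U =>
    {h : forall x y : Ob G, is_prop (Hom G x y)
         & is_univalent (id_idempotent_prop h)}).
  apply equiv_sym.
  refine (equiv_trans (B := {X : semi_segal_deg_2 U & T (graph_of_segal2 X)})
     _ (equiv_trans (B := {G : rt_graph U & T G}) _ _)).
  - refine (@equiv_of_inverse (univalent_semi_segal_set U)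
      {X : semi_segal_deg_2 U & T (graph_of_segal2 X)}
      (fun X => existT _ (usss_carrier X)
         (existT _ (@usss_prop U X) (@usss_univalent U X)))
      (fun u => Build_univalent_semi_segal_set (projT2 (projT2 u))) _ _).
    + intros [X [h k]]. reflexivity.
    + reflexivity.
  - exact (equiv_sigma (e := existT _ _ (is_equiv_graph ua))
             (fun X => equiv_id _)).
  - refine (@equiv_of_inverse {G : rt_graph U & T G} (poset U)
      (fun u => Build_poset (projT2 (projT2 u)))
      (fun G => existT _ (poset_graph G)
         (existT _ (@poset_prop U G) (@poset_univalent U G))) _ _).
    + reflexivity.
    + intros [X [h k]]. reflexivity.
Qed.

Lemma equiv_category_semi_segal_1type (U : universe) (ua : univalence U) :
  univalent_category U <~> univalent_semi_segal_1type U.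
Proof.
  pose (S := fun X : semi_segal_deg_3 U =>
    ((forall x y, is_set (A1 X x y))
     * is_univalent
         (id_idempotent_semi_segal (segal3_fill2 X) (segal3_deg X)))%type).
  pose (T := fun C : wild_precategory U =>
    ((forall x y, is_set (Hom C x y))
     * is_univalent (id_idempotent_precat C))%type).
  apply equiv_sym.
  refine (equiv_trans (B := {X : semi_segal_deg_3 U & S X})
     _ (equiv_trans (B := {C : wild_precategory U & T C}) _ _)).
  - refine (@equiv_of_inverse (univalent_semi_segal_1type U)
      {X : semi_segal_deg_3 U & S X}
      (fun X => existT _ (uss1_carrier X) (@uss1_set U X, @uss1_univalent U X))
      (fun u => Build_univalent_semi_segal_1type (fst (projT2 u)) (snd (projT2 u)))
      _ _).
    + intros [X [h k]]. reflexivity.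
    + reflexivity.
  - refine (equiv_sigma (e := existT _ _ (is_equiv_precat ua))
      (fun X => equiv_prod (equiv_id _) _)).
    exact (@equiv_is_univalent U (precat_of_segal3 X) _ _).
  - refine (@equiv_of_inverse {C : wild_precategory U & T C}
      (univalent_category U)
      (fun u => Build_univalent_category (fst (projT2 u)) (snd (projT2 u)))
      (fun C => existT _ (ucat_precat C) (@ucat_set U C, @ucat_univalent U C)) _ _).
    + reflexivity.
    + intros [C [h k]]. reflexivity.
Qed.

Lemma equiv_2category_semi_segal_2type (U : universe) (ua : univalence U) :
  univalent_2category U <~> univalent_semi_segal_2type U.
Proof.
  pose (S := fun X : semi_segal_deg_4 U =>
    ((forall x y, is_1type (A1 X x y))
     * is_univalent
         (id_idempotent_semi_segal (segal4_fill2 X) (segal4_deg X)))%type).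
  pose (T := fun C : wild_2precategory U =>
    ((forall x y, is_1type (Hom C x y))
     * is_univalent (id_idempotent_precat C))%type).
  apply equiv_sym.
  refine (equiv_trans (B := {X : semi_segal_deg_4 U & S X})
     _ (equiv_trans (B := {C : wild_2precategory U & T C}) _ _)).
  - refine (@equiv_of_inverse (univalent_semi_segal_2type U)
      {X : semi_segal_deg_4 U & S X}
      (fun X => existT _ (uss2_carrier X) (@uss2_1type U X, @uss2_univalent U X))
      (fun u => Build_univalent_semi_segal_2type (fst (projT2 u)) (snd (projT2 u)))
      _ _).
    + intros [X [h k]]. reflexivity.
    + reflexivity.
  - refine (equiv_sigma (e := equiv_2precat ua)
      (fun X => equiv_prod (equiv_id _) _)).
    exact (@equiv_is_univalent U (projT1 (equiv_2precat ua) X) _ _).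
  - refine (@equiv_of_inverse {C : wild_2precategory U & T C}
      (univalent_2category U)
      (fun u => Build_univalent_2category (fst (projT2 u)) (snd (projT2 u)))
      (fun C => existT _ (u2cat_2precat C) (@u2cat_1type U C, @u2cat_univalent U C)) _ _).
    + reflexivity.
    + intros [C [h k]]. reflexivity.
Qed.

Theorem theorem4p22 (U : universe) (ua : univalence U) :
  (poset U <~> univalent_semi_segal_set U) *
  (univalent_category U <~> univalent_semi_segal_1type U) *
  (univalent_2category U <~> univalent_semi_segal_2type U).
Proof.
  exact (equiv_poset_semi_segal_set ua, equiv_category_semi_segal_1type ua,
         equiv_2category_semi_segal_2type ua).
Qed.
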